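(* Let $I$ be a finite set and let $C$ be a finite set of partially defined real-valued functions on $I$, each $c\in C$ having a nonempty domain $\mathrm{Dom}(c)\subseteq I$, such that for every $i\in I$ the set $C$ contains a function with domain $\{i\}$. Then there exists a compromise function $x:I\to\mathbb R$ for $C$, i.e. a function such that (1) for every $c\in C$ there is $i\in\mathrm{Dom}(c)$ with $c(i)\le x(i)$, and (2) for every $i\in I$ there is $c\in C$ with $i\in\mathrm{Dom}(c)$ and $x(j)\le c(j)$ for all $j\in\mathrm{Dom}(c)$. *)

(* Defs.v *)
From mathcomp Require Import all_boot all_order all_algebra.
From mathcomp Require Import finmap reals.
Set Implicit Arguments.
Unset Strict Implicit.
Unset Printing Implicit Defensive.
Import Order.TTheory GRing.Theory Num.Theory.
Local Open Scope ring_scope.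

(* A partially defined function on I with values in R: [c i = Some r] means *)
(* that i is in the domain of c and c(i) = r. *)
Notation partial_fun I R := {ffun I -> option R}.

Definition Dom (I : finType) (R : realType) (c : partial_fun I R) : {set I} :=
  [set i | c i != None].

Definition compromise (I : finType) (R : realType)
    (C : {fset partial_fun I R}) (x : I -> R) : Prop :=
  (forall c, c \in C -> exists i r, c i = Some r /\ r <= x i) /\
  (forall i, exists c, [/\ c \in C, i \in Dom c &
     forall j r, c j = Some r -> x j <= r]).

(* Main.v *)
Require Import Defs.
From mathcomp Require Import all_boot all_order all_algebra.
From mathcomp Require Import finmap reals.
Set Implicit Arguments.
Unset Strict Implicit.
Unset Printing Implicit Defensive.
Import Order.TTheory GRing.Theory Num.Theory.
Local Open Scope ring_scope.

(** Condition (1) holds for every sufficiently large function, and condition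
    (2) at a point [i] survives when [x] is decreased.  Hence one starts from a
    large [x] and lowers its coordinates one after the other, each as far as
    condition (1) permits: the obstruction to lowering [x i] any further is a
    function [c] of [C] that witnesses condition (2) at [i]. *)

Definition dominating (I : finType) (R : realType)
    (C : {fset partial_fun I R}) (x : I -> R) : Prop :=
  forall c, c \in C -> exists i r, c i = Some r /\ r <= x i.

Definition supported_at (I : finType) (R : realType)
    (C : {fset partial_fun I R}) (x : I -> R) (i : I) : Prop :=
  exists c, [/\ c \in C, i \in Dom c & forall j r, c j = Some r -> x j <= r].

Lemma supported_at_le (R : realType) (I : finType)
    (C : {fset partial_fun I R}) (x y : I -> R) (i : I) :
  (forall j, y j <= x j) -> supported_at C x i -> supported_at C y i.
Proof.
move=> yx [c [cC ic xc]]; exists c; split=> // j r cj.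
exact: le_trans (yx j) (xc j r cj).
Qed.

Lemma exists_dominating (R : realType) (I : finType)
    (C : {fset partial_fun I R}) :
  (forall c, c \in C -> Dom c != set0) -> exists x, dominating C x.
Proof.
move=> domC; pose v (c : partial_fun I R) i := `|odflt 0 (c i)|.
(* With absolute values, and 0 off the domain, every summand is nonnegative, so the sum bounds each
   single [c i]. *)
exists (fun i => \sum_(c : C) v (val c) i) => c cC.
have /set0Pn[i] := domC _ cC; rewrite inE.
case ci: (c i) => [r|] // _; exists i, r; split=> //.
rewrite (bigD1 [` cC]%fset) //= {1}/v ci /=.
apply: le_trans (ler_norm r) _; rewrite lerDl sumr_ge0 // => d _.
exact: normr_ge0.
Qed.

(** The lowest admissible value at [i] is the largest [c i] among those [c] that can meet condition
    (1) only at [i]; a [c] attaining it supports [i]. *)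
Lemma lower_coordinate (R : realType) (I : finType)
    (C : {fset partial_fun I R}) (x : I -> R) (i : I) :
  (exists2 c, c \in C & Dom c = [set i]) -> dominating C x ->
  exists y, [/\ dominating C y, forall j, y j <= x j & supported_at C y i].
Proof.
move=> [c0 c0C dom_c0] domx.
(* [P] selects the [c] defined at [i] and strictly above [x] at all other points of their domain. *)
pose P (c : C) := (val c i != None) &&
  [forall j, (j != i) ==> (if val c j is Some r then x j < r else true)].
pose F (c : C) : R := odflt 0 (val c i).
(* The function with domain [{i}] satisfies [P] vacuously off [i], so the maximum exists. *)
have Pc0 : P [` c0C]%fset.
  apply/andP; split; first by have := set11 i; rewrite -dom_c0 inE.
  apply/forallP => j; apply/implyP => ji /=.
  have : j \notin Dom c0 by rewrite dom_c0 inE.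
  by rewrite inE negbK => /eqP ->.
case: (@Order.TotalTheory.arg_maxP _ _ C _ P F Pc0) => m Pm maxm.
have /andP[mi /forallP mlt] := Pm.
exists (fun j => if j == i then F m else x j); split.
- move=> c cC.
  have [Pc|nPc] := boolP (P [` cC]%fset).
    have := maxm _ Pc; case/andP: Pc => /= + _; rewrite {1}/F /=.
    by case ci: (c i) => [r|] //= _ ler; exists i, r; rewrite eqxx.
  (* Outside [P], condition (1) already holds at some [j] other than [i], where [x] is unchanged. *)
  move: nPc; rewrite negb_and negbK /= => /orP[/eqP ci|].
    have [j [r [cj rx]]] := domx _ cC; exists j, r; split=> //.
    by case: eqP => // ji; rewrite ji ci in cj.
  rewrite negb_forall => /existsP[j]; rewrite negb_imply => /andP[ji].
  case cj: (c j) => [r|] //; rewrite -leNgt => rx.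
  by exists j, r; rewrite (negbTE ji).
- move=> j; case: eqP => // ->.
  (* Since [m] satisfies [P], the point where [x] dominates [m] can only be [i], hence
     [F m <= x i]. *)
  have [k [r [mk rx]]] := domx _ (valP m).
  have [ki|ki] := eqVneq k i; first by rewrite -ki /F -ki mk.
  by have := mlt k; rewrite ki mk /= ltNge rx.
- exists (val m); split; [exact: valP | by rewrite inE |] => j r mj.
  have [ji|ji] := eqVneq j i; first by rewrite /F -ji mj.
  by have := mlt j; rewrite ji mj => /ltW.
Qed.

Theorem theoremB1 (R : realType) (I : finType) (C : {fset partial_fun I R})
    (domC_neq0 : forall c, c \in C -> Dom c != set0)
    (singC : forall i : I, exists2 c, c \in C & Dom c = [set i]) :
  exists x : I -> R, compromise C x.
Proof.
(* Asking for support only along a list permits induction: lowering one more coordinate preserves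
   the support of those already treated. *)
suff [x [domx suppx]] : exists x, dominating C x /\
    forall i, i \in enum I -> supported_at C x i.
  by exists x; split=> // i; apply: suppx; rewrite mem_enum.
elim: (enum I) => [|i s [x [domx suppx]]].
  by have [x domx] := exists_dominating domC_neq0; exists x.
have [y [domy yx suppy]] := lower_coordinate (singC i) domx.
exists y; split=> // j; rewrite inE => /orP[/eqP -> //|js].
exact: supported_at_le yx (suppx j js).
Qed.
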